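(* Let $(p,q)$ be a non-strict pair of distinct points in a normed plane $(\mathbb{R}^2,\|\cdot\|)$, and let $s_t$ and $B_t^1$ be the point and the part of the bisector defined in the context. Then for all $z\in B_t^1$, the set $B_t^1$ is contained in the double cone $$\{z+\lambda(p-z)+\mu(q-z):\lambda,\mu\in\mathbb{R},\ \lambda\mu\ge 0\}.$$ In particular, $B_t^1\subset\operatorname{conv}(\{p,q,s_t\})$.
   Context: $(\mathbb{R}^2,\|\cdot\|)$ is an arbitrary two-dimensional real normed space (no strict convexity or smoothness assumed) with unit ball $B=\{x:\|x\|\le 1\}$ and unit circle $\operatorname{bd}(B)$; $\operatorname{conv}$ denotes convex hull. The bisector of $p\neq q$ is $\operatorname{bis}(p,q)=\{z\in\mathbb{R}^2:\|z-p\|=\|z-q\|\}$. The pair $(p,q)$ is called strict if $\operatorname{bd}(B)$ contains no (nondegenerate) line segment parallel to $p-q$; otherwise it is non-strict. For distinct $x,y$: $\langle x,y\rangle=\{\lambda y+(1-\lambda)x:\lambda\in\mathbb{R}\}$ (line), $[x,y\rangle=\{\lambda y+(1-\lambda)x:\lambda\ge 0\}$ (ray from $x$ through $y$). Orientation: one of the two sides of the line $\langle p,q\rangle$ is called ''above'', the other ''below'' (i.e. fix a nonzero linear functional $\psi$ with $\psi(p-q)=0$ and let ''above'' mean larger $\psi$). On lines parallel to $\langle p,q\rangle$, ''left to right'' is the direction of $q-p$. Points: let $L_{\text{top}}$ be the common supporting line of $p+B$ and $q+B$ that is parallel to $\langle p,q\rangle$ and lies above it. Write $L_{\text{top}}\cap(\operatorname{bd}(B)+p)=[t_p,t_p']$,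 where $t_p$ is the left and $t_p'$ the right endpoint, and $L_{\text{top}}\cap(\operatorname{bd}(B)+q)=[t_q',t_q]$, where $t_q'$ is the left and $t_q$ the right endpoint. Let $s_t$ be the intersection point of the rays $[p,t_p'\rangle$ and $[q,t_q'\rangle$. Let $R_1=\operatorname{conv}\bigl([p,t_p\rangle\cup[q,t_q\rangle\bigr)\setminus\langle p,q\rangle$ and $$B_t^1=\bigcup_{\lambda\in(\frac12\|p-q\|,\ \|s_t-p\|]}\{z\in R_1:\|z-p\|=\|z-q\|=\lambda\}.$$ *)

(* Defs.v *)
From HB Require Import structures.
From mathcomp Require Import all_boot all_order all_algebra.
From mathcomp Require Import all_classical all_reals all_analysis.

Set Implicit Arguments.
Unset Strict Implicit.
Unset Printing Implicit Defensive.

Import Order.TTheory GRing.Theory Num.Theory.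
Import numFieldNormedType.Exports.

Local Open Scope classical_set_scope.
Local Open Scope ring_scope.

Section NormedPlane.
Context {R : realType} {V : normedModType R}.
Implicit Types (x y z p q : V) (A K L : set V).

Definition line x y : set V :=
  [set l *: y + (1 - l) *: x | l in [set: R]].

Definition ray x y : set V :=
  [set l *: y + (1 - l) *: x | l in [set l : R | 0 <= l]].

Definition segment x y : set V :=
  [set l *: y + (1 - l) *: x | l in [set l : R | 0 <= l <= 1]].

Definition conv_hull A : set V := smallest (@convex_set R V) A.

Definition unit_ball : set V := [set x | `|x| <= 1].

Definition bd A : set V := closure A `\` interior A.

Definition translate A p : set V := [set x + p | x in A].

Definition strict_pair p q : Prop :=
  ~ exists x y, [/\ x <> y, segment x y `<=` bd unit_ball
                  & exists k : R, y - x = k *: (p - q)].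

(* In dimension two, the lines are exactly the level sets of the nonzero
   linear functionals. *)
Definition supporting_line K L : Prop :=
  exists (phi : {scalar V}) (c : R),
    [/\ exists v, phi v <> 0,
        L = [set x | phi x = c],
        K `<=` [set x | phi x <= c]
      & L `&` K !=set0].

Definition parallel_to L p q : Prop := exists a, L = line a (a + (q - p)).

Definition left_to_right p q x y : Prop :=
  exists2 k : R, 0 <= k & y - x = k *: (q - p).

(* "Above" means towards larger values of psi, a nonzero functional vanishing
   on p - q. *)
Definition top_line (psi : {scalar V}) p q L : Prop :=
  [/\ supporting_line (translate unit_ball p) L,
      supporting_line (translate unit_ball q) L,
      parallel_to L p q
    & forall x, L x -> psi p < psi x].

(* The region R_1; tp and tq are t_p and t_q. *)
Definition region1 p q tp tq : set V :=
  conv_hull (ray p tp `|` ray q tq) `\` line p q.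

(* The set B_t^1; st is s_t. *)
Definition bis_top1 p q tp tq st : set V :=
  \bigcup_(l in [set l : R | `|p - q| / 2 < l <= `|st - p|])
    [set z | [/\ region1 p q tp tq z, `|z - p| = l & `|z - q| = l]].

Definition double_cone p q z : set V :=
  [set w | exists l m : R, 0 <= l * m /\ w = z + l *: (p - z) + m *: (q - z)].

End NormedPlane.

(* Main.v *)
Require Import Defs.
From mathcomp Require Import all_boot all_order all_algebra.
From mathcomp Require Import all_classical all_reals all_analysis.
From mathcomp Require Import ring lra.
Import Order.TTheory GRing.Theory Num.Theory.
Import numFieldNormedType.Exports.
Local Open Scope classical_set_scope.
Local Open Scope ring_scope.

(** Put [e = q - p] and [v = tp - p], and write [pt x y] for [p + x e + y v].
    As [q + B] is [p + B] shifted along the supporting line, the four contact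
    points are [tp = pt 0 1], [tp' = pt k 1], [tq' = pt 1 1] and
    [tq = pt (1 + k) 1] for some [k >= 0]. The rays that define [st] meet only
    if [k > 0], and then [st = pt 1 (1 / k)] is at distance [1 / k] from [p].

    Everything about the norm is contained in two facts: for [y > 0] one has
    [y <= |x e + y v|] (the supporting line, [le_norm_vec]), with equality
    exactly when [0 <= x <= k y] (the contact segment, [norm_vec_eq]).
    Consequently ([equidistant_strip]) an equidistant point [pt x y] of [R_1] at
    distance at most [1 / k] is either [st], or it satisfies [k y < x < 1] and
    its distance to [p] and [q] is strictly larger than [y]. Such points lie in
    the triangle [p], [q], [st], which is the second claim.

    For the first claim let [z = pt x y] and [w] be of the second kind, and
    suppose that [w = z + l (p - z) + m (q - z)] with, say, [l > 0 > m]. Then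
    [w] arises from [z] by moving towards [p] and away from [q], so the triangle
    inequality gives [|w - p| <= |w - q|]. The inequality is strict
    ([normr_towards_away_lt]) because the segment from [z - p] to [z - q], whose
    ends have the same norm, passes through [y v], whose norm [y] is strictly
    smaller. Hence [w] is not equidistant. If [z] or [w] is [st], the claim
    is read off the coordinates ([bis_coord_double_cone]). *)

(** * The unit circle, strict convexity along a chord, convex combinations *)

Lemma bd_unit_ballE (R : realType) (V : normedModType R) :
  bd (@unit_ball R V) = [set x | `|x| = 1].
Proof.
have -> : @unit_ball R V = closed_ball 0 1.
  by rewrite closed_ballE //; apply/seteqP; split=> x;
    rewrite /closed_ball_ /unit_ball /= sub0r normrN.
rewrite /bd interior_closed_ballE // -(closure_id _).1; last exact: closed_ball_closed.
rewrite closed_ballE // -ball_normE.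
apply/seteqP; split=> x; rewrite /closed_ball_ /= sub0r normrN.
  by move=> [x1 /negP]; rewrite -leNgt => x1'; apply/eqP; rewrite eq_le x1.
by move=> ->; split=> //; rewrite ltxx.
Qed.

(** A point of norm below [r] inside a chord of the sphere of radius [r] makes
    the norm strictly less than [r] on the whole open chord, by convexity; the
    statement is the homogeneous form of this. *)
Lemma normr_cone_lt (R : realType) (V : normedModType R) (a b : V) (r t c d : R) :
  `|a| = r -> `|b| = r -> 0 < t -> t < 1 -> `|(1 - t) *: a + t *: b| < r ->
  0 < c -> 0 < d -> `|c *: a + d *: b| < (c + d) * r.
Proof.
(* Exchanging [a] and [b] puts the direction of [c a + d b] between [a] and the
   interior point [(1 - t) a + t b]. *)
wlog dct : a b t c d / d * (1 - t) <= c * t => [hwlog|] ha hb t0 t1 hab c0 d0.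
  have [dct|/ltW cdt] := leP (d * (1 - t)) (c * t); first exact: (hwlog a b t).
  rewrite addrC (addrC c); apply: (hwlog b a (1 - t)) => //; try by lra.
  by rewrite addrC (_ : 1 - (1 - t) = t) //; ring.
have -> : c *: a + d *: b =
    (c + d - d / t) *: a + (d / t) *: ((1 - t) *: a + t *: b).
  have tn0 : t != 0 by lra.
  rewrite scalerDr !scalerA addrA -scalerDl; congr (_ *: _ + _ *: _); by field.
have dt0 : 0 < d / t by exact: divr_gt0.
have cd0 : 0 <= c + d - d / t.
  by rewrite subr_ge0 ler_pdivrMr //; lra.
apply: (le_lt_trans (ler_normD _ _)).
rewrite 2!normrZ ha (ger0_norm cd0) (gtr0_norm dt0).
have : d / t * `|(1 - t) *: a + t *: b| < d / t * r by rewrite ltr_pM2l.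
by lra.
Qed.

(** If [a = z - p] and [b = z - q], the vectors compared are [w - p] and [w - q]
    for [w = z + l (p - z) - n (q - z)]. Both are compared with
    [(1 - l + n) r]: the first by strict convexity, the second by the reverse
    triangle inequality. *)
Lemma normr_towards_away_lt (R : realType) (V : normedModType R)
    (a b : V) (r t l n : R) :
  `|a| = r -> `|b| = r -> 0 < t -> t < 1 -> `|(1 - t) *: a + t *: b| < r ->
  l < 1 -> 0 < l -> 0 < n ->
  `|(1 - l) *: a + n *: b| < `|(1 + n) *: b - l *: a|.
Proof.
move=> ha hb t0 t1 hab l1 l0 n0.
apply: (@lt_le_trans _ _ ((1 - l + n) * r)).
  by apply: (normr_cone_lt _ _ _ _ _ t) => //; lra.
apply: le_trans (lerB_dist _ _).
rewrite !normrZ ha hb gtr0_norm ?gtr0_norm //; lra.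
Qed.

Lemma convex_set_comb (R : realType) (V : normedModType R) (S : set V)
    (a b : V) (t : R) :
  @convex_set R V S -> S a -> S b -> 0 <= t <= 1 -> S (t *: a + (1 - t) *: b).
Proof.
move=> convS Sa Sb t01.
have tspec : Itv.spec (@Itv.num_sem R) (Itv.Real `[0%Z, 1%Z]) t.
  by rewrite /Itv.spec /= /Itv.num_sem /= in_itv /= t01 ger0_real //; case/andP: t01.
pose tt : {i01 R} := Itv.mk tspec.
by have := @convS a b tt; rewrite !inE => /(_ Sa Sb).
Qed.

(** * Coordinates *)

Section Coordinates.
Context {R : realType} {V : normedModType R}.
Implicit Types (p e v : V) (x y c k l m : R).

(** Vectors and points in the frame with origin [p] and axes [e] and [v];
    in this form identities between vectors reduce to ring identities between
    coordinates. *)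
Definition vec e v x y : V := x *: e + y *: v.

Definition pt p e v x y : V := p + vec e v x y.

Lemma vecD e v x y x' y' : vec e v x y + vec e v x' y' = vec e v (x + x') (y + y').
Proof. by rewrite /vec addrACA -!scalerDl. Qed.

Lemma vecN e v x y : - vec e v x y = vec e v (- x) (- y).
Proof. by rewrite /vec opprD !scaleNr. Qed.

Lemma vecZ e v c x y : c *: vec e v x y = vec e v (c * x) (c * y).
Proof. by rewrite /vec scalerDr !scalerA. Qed.

Definition vecE := (vecD, vecN, vecZ).

Lemma pt_vec p e v x y x' y' :
  pt p e v x y + vec e v x' y' = pt p e v (x + x') (y + y').
Proof. by rewrite /pt -addrA vecD. Qed.

Lemma pt_addl p e v x y c : pt p e v x y + c *: e = pt p e v (x + c) y.
Proof. by rewrite /pt /vec scalerDl -addrA addrAC. Qed.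

Lemma ptB p e v x y x' y' :
  pt p e v x y - pt p e v x' y' = vec e v (x - x') (y - y').
Proof. by rewrite /pt opprD addrACA subrr add0r !vecE. Qed.

Lemma ptBl p e v x y : pt p e v x y - p = vec e v x y.
Proof. by rewrite /pt addrAC subrr add0r. Qed.

Lemma pt_conv p e v l x y x' y' :
  l *: pt p e v x y + (1 - l) *: pt p e v x' y' =
  pt p e v (l * x + (1 - l) * x') (l * y + (1 - l) * y').
Proof.
rewrite /pt (scalerDr l p) (scalerDr (1 - l) p) addrACA -scalerDl (_ : l + (1 - l) = 1) ?scale1r; last by ring.
by rewrite !vecE.
Qed.

Lemma pt00 p e v : pt p e v 0 0 = p.
Proof. by rewrite /pt /vec !scale0r !addr0. Qed.

Lemma pt_inj p e v x x' y : e != 0 -> pt p e v x y = pt p e v x' y -> x = x'.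
Proof.
move=> e0 /addrI /addIr /eqP; rewrite -subr_eq0 -scalerBl scaler_eq0 (negPf e0) orbF.
by rewrite subr_eq0 => /eqP.
Qed.

Lemma line_ptE p e v : line p (pt p e v 1 0) = [set pt p e v x 0 | x in [set: R]].
Proof.
have lineE x : x *: pt p e v 1 0 + (1 - x) *: p = pt p e v x 0.
  by rewrite -[X in (1 - x) *: X](pt00 p e v) pt_conv; congr pt; ring.
by apply/seteqP; split=> _ [x _ <-]; exists x; rewrite ?lineE.
Qed.

(** The coordinate region in the conclusion, closed up by [y = 0], is convex and
    contains both rays; removing the line through [p] and [q] leaves [0 < y]. *)
Lemma region1_sub_pt p e v k z : 0 <= k ->
  region1 p (pt p e v 1 0) (pt p e v 0 1) (pt p e v (1 + k) 1) z ->
  exists x y, [/\ z = pt p e v x y, 0 < y & 0 <= x <= 1 + k * y].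
Proof.
move=> k0 [hz nl].
pose S := [set pt p e v w.1 w.2 | w in
  [set w : R * R | 0 <= w.2 /\ 0 <= w.1 <= 1 + k * w.2]].
have : S z.
  move: hz; apply: smallest_sub => [a b t|_ [|] [l /= l0 <-]].
  - rewrite !inE => -[[x y] /= [y0 /andP[x0 x1]] <-] [[x' y'] /= [y0' /andP[x0' x1']] <-].
    have t0 : 0 <= t%:num by [].
    have t1 : 0 <= 1 - t%:num by rewrite subr_ge0.
    exists (t%:num * x + (1 - t%:num) * x', t%:num * y + (1 - t%:num) * y') => /=.
      have := mulr_ge0 t0 x0; have := mulr_ge0 t1 x0'.
      have := mulr_ge0 t0 y0; have := mulr_ge0 t1 y0'.
      have := ler_wpM2l t0 x1; have := ler_wpM2l t1 x1'.
      by move=> *; lra.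
    by rewrite -pt_conv.
  - exists (0, l); last by rewrite -[X in (1 - l) *: X](pt00 p e v) pt_conv /=; congr pt; ring.
    by have := mulr_ge0 k0 l0; split=> //=; lra.
  - exists (1 + k * l, l); last by rewrite pt_conv /=; congr pt; ring.
    by have := mulr_ge0 k0 l0; split=> //=; lra.
move=> [[x y] /= [y0 xb] zE].
exists x, y; split=> //; rewrite lt_neqAle y0 andbT eq_sym; apply/eqP => yE.
by apply: nl; rewrite line_ptE; exists x; rewrite // -zE yE.
Qed.

(** * The bisector in coordinates *)

(** [top_ge1] and [top_eq1] say that the horizontal line at height 1 supports the
    unit ball and touches it in the segment [0 <= x <= k]. *)
Section NormOnTop.
Variables (e v : V) (k : R).
Hypothesis k0 : 0 < k.
Hypothesis top_ge1 : forall x, 1 <= `|vec e v x 1|.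
Hypothesis top_eq1 : forall x, `|vec e v x 1| = 1 <-> 0 <= x <= k.

Lemma vec_scale_top x y : 0 < y -> `|vec e v x y| = y * `|vec e v (x / y) 1|.
Proof.
move=> y0; rewrite -{2}(gtr0_norm y0) -normrZ vecZ; congr (`|vec _ _ _ _|).
  by field; lra.
by rewrite mulr1.
Qed.

Lemma le_norm_vec x y : 0 < y -> y <= `|vec e v x y|.
Proof. by move=> y0; rewrite vec_scale_top // ler_peMr // ltW. Qed.

Lemma norm_vec_eq x y : 0 < y -> `|vec e v x y| = y <-> 0 <= x <= k * y.
Proof.
move=> y0; rewrite vec_scale_top //.
rewrite -(ler_pdivrMr _ _ y0) -[in 0 <= x](mul0r y) -(ler_pdivlMr _ _ y0).
rewrite -top_eq1; split=> [|->]; last by rewrite mulr1.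
by rewrite -[RHS]mulr1 => /mulfI; apply; lra.
Qed.

(** If [x <= k y], then the common norm is [y], so that [x - 1] is in the contact
    range as well, whence [1 <= x <= k y <= 1]. If [x > k y], then the norm
    exceeds [y], so that [x - 1] is outside the contact range, and it can only
    be on its left. *)
Lemma equidistant_strip x y :
  0 < y -> 0 <= x <= 1 + k * y ->
  `|vec e v x y| = `|vec e v (x - 1) y| -> `|vec e v x y| <= k^-1 ->
  (x = 1 /\ y = k^-1) \/ (k * y < x < 1 /\ y < `|vec e v x y|).
Proof.
move=> y0 /andP[x0 x1] eqn len.
have [xk|kx] := leP x (k * y).
  left; have ny : `|vec e v x y| = y by apply/norm_vec_eq; rewrite ?x0.
  have /norm_vec_eq - /(_ y0)/andP[x10 _] : `|vec e v (x - 1) y| = y by rewrite -eqn.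
  have : k * y <= 1 by rewrite mulrC -ler_pdivlMr // div1r -ny.
  move=> ky1; have {}ky1 : k * y = 1 by lra.
  split; first lra.
  by apply: (mulfI (lt0r_neq0 k0)); rewrite ky1 mulfV ?lt0r_neq0.
right.
have ylt : y < `|vec e v x y|.
  rewrite lt_neqAle le_norm_vec // andbT eq_sym; apply/eqP => /norm_vec_eq - /(_ y0).
  lra.
split=> //; apply/andP; split=> //; rewrite ltNge; apply/negP => x1'.
have : `|vec e v (x - 1) y| = y by apply/norm_vec_eq => //; lra.
by rewrite -eqn => ny; rewrite ny ltxx in ylt.
Qed.

(** The conditions that the points [pt x y] of the bisector part satisfy; the
    first alternative is the point [st]. *)
Definition bis_coord x y :=
  [/\ 0 < y, `|vec e v x y| = `|vec e v (x - 1) y|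
    & (x = 1 /\ y = k^-1) \/ (k * y < x < 1 /\ y < `|vec e v x y|)].

(** The equations say that [pt x' y'] is
    [z + l (p - z) + m (q - z)] for [z = pt x y]. *)
Lemma bis_coord_double_cone x y x' y' :
  bis_coord x y -> bis_coord x' y' ->
  exists l m, [/\ 0 <= l * m, x' = x - l * x + m * (1 - x) & y' = y - (l + m) * y].
Proof.
move=> [y0 eqn hz] [y0' eqn' hw].
have yn0 : y != 0 by exact: lt0r_neq0.
have kn0 : k != 0 by exact: lt0r_neq0.
(* The heights determine [s = l + m], and then the abscissas determine [m]. *)
pose s := (y - y') / y; pose m := x' - x + x * s; pose l := s - m.
have sy : s * y = y - y' by rewrite /s; field.
have hx : x' = x - l * x + m * (1 - x) by rewrite /l /m; ring.
have hy : y' = y - (l + m) * y by rewrite (_ : l + m = s) ?sy /l; ring.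
exists l, m; split=> //.
case: hz => [[x1 yk]|[/andP[kyx x1] ylt]].
  have sk : s = 1 - k * y' by rewrite /s yk; field.
  have ky1 : k * y = 1 by rewrite yk mulfV.
  apply: mulr_ge0; rewrite /l /m sk x1; case: hw => [[-> ->]|[/andP[] *]]; rewrite ?mulfV //; lra.
have ky0 : 0 < k * y by exact: mulr_gt0.
have x0 : 0 < x by exact: lt_trans kyx.
case: hw => [[x1' yk']|[/andP[kyx' x1'] ylt']].
  have sk : s = 1 - (k * y)^-1 by rewrite /s yk'; field; rewrite kn0 yn0.
  have ky1 : (k * y)^-1 * x >= 1 by rewrite mulrC ler_pdivlMr // mul1r ltW.
  have : (k * y)^-1 * (1 - x) >= 0 by rewrite mulr_ge0 ?invr_ge0; lra.
  by move=> ?; apply: mulr_le0; rewrite /l /m sk x1'; lra.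
have x0' : 0 < x' by apply: lt_trans kyx'; exact: mulr_gt0.
(* The chord from [z - p] to [z - q] passes through this vector at parameter [x]. *)
have mid : `|vec e v 0 y| = y by apply/norm_vec_eq; rewrite // lexx ltW.
rewrite leNgt; apply/negP => lm0.
have [l0|l0] := ltP 0 l.
  (* Towards [p], away from [q]. *)
  have m0 : m < 0 by rewrite -(pmulr_rlt0 _ l0).
  (* For [l >= 1] the point would have moved past [p], to the left of it. *)
  have l1 : l < 1.
    rewrite ltNge; apply/negP => l1.
    have : 0 <= (l - 1) * x + (- m) * (1 - x) by apply: addr_ge0; apply: mulr_ge0; lra.
    by rewrite hx in x0'; lra.
  suff : `|vec e v x' y'| < `|vec e v (x' - 1) y'| by rewrite eqn' ltxx.
  have := @normr_towards_away_lt _ _ (vec e v x y) (vec e v (x - 1) y)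
    `|vec e v x y| x l (- m) erefl (esym eqn) x0 x1.
  rewrite !vecE => /(_ _ l1 l0); rewrite oppr_gt0 => /(_ _ m0).
  have -> : (1 - x) * x + x * (x - 1) = 0 by ring.
  have -> : (1 - x) * y + x * y = y by ring.
  rewrite mid => /(_ ylt).
  by congr (`|vec _ _ _ _| < `|vec _ _ _ _|); rewrite ?hx ?hy; ring.
(* Towards [q], away from [p]: the same with the roles exchanged. *)
have {lm0 l0} [l0 m0] : l < 0 /\ 0 < m.
  move: l0; rewrite le_eqVlt => /orP[/eqP l0|l0]; first by rewrite l0 mul0r ltxx in lm0.
  by split=> //; rewrite -(nmulr_rlt0 _ l0).
have m1 : m < 1.
  rewrite ltNge; apply/negP => m1.
  have : 0 <= (m - 1) * (1 - x) + (- l) * x by apply: addr_ge0; apply: mulr_ge0; lra.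
  by rewrite hx in x1'; lra.
suff : `|vec e v (x' - 1) y'| < `|vec e v x' y'| by rewrite eqn' ltxx.
have x0c : 0 < 1 - x by lra.
have x1c : 1 - x < 1 by lra.
have := @normr_towards_away_lt _ _ (vec e v (x - 1) y) (vec e v x y)
  `|vec e v x y| (1 - x) m (- l) (esym eqn) erefl x0c x1c.
rewrite !vecE => /(_ _ m1 m0); rewrite oppr_gt0 => /(_ _ l0).
have -> : (1 - (1 - x)) * (x - 1) + (1 - x) * x = 0 by ring.
have -> : (1 - (1 - x)) * y + (1 - x) * y = y by ring.
rewrite mid => /(_ ylt).
by congr (`|vec _ _ _ _| < `|vec _ _ _ _|); rewrite ?hx ?hy; ring.
Qed.

End NormOnTop.

(** The point [pt x y] has the barycentric coordinates [1 - x], [x - k y] and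
    [k y]. *)
Lemma bis_coord_conv p e v k x y : 0 < k -> bis_coord e v k x y ->
  conv_hull [set p; pt p e v 1 0; pt p e v 1 k^-1] (pt p e v x y).
Proof.
move=> k0 [y0 _ hz] S [convS subS].
have [Sp Sq Ss] : [/\ S p, S (pt p e v 1 0) & S (pt p e v 1 k^-1)].
  by split; apply: subS; [left; left | left; right | right].
case: hz => [[-> ->] //|[/andP[kyx x1] _]].
have ky0 : 0 < k * y by exact: mulr_gt0.
have kn0 : k != 0 by exact: lt0r_neq0.
have xn0 : x != 0 by apply: lt0r_neq0; exact: lt_trans kyx.
(* The ray from [p] through [pt x y] meets the side from [q] to [st] here. *)
have Sw : S (pt p e v 1 (y / x)).
  have := convex_set_comb _ _ _ _ _ (k * y / x) convS Ss Sq; rewrite pt_conv.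
  have -> : k * y / x * 1 + (1 - k * y / x) * 1 = 1 by ring.
  have -> : k * y / x * k^-1 + (1 - k * y / x) * 0 = y / x by field; rewrite xn0 kn0.
  apply; apply/andP; split; first by rewrite divr_ge0 ?ltW //; exact: lt_trans kyx.
  by rewrite ler_pdivrMr ?mul1r ?ltW //; exact: lt_trans kyx.
have := convex_set_comb _ _ _ _ _ x convS Sw Sp; rewrite -[X in (1 - x) *: X](pt00 p e v) pt_conv.
have -> : x * 1 + (1 - x) * 0 = x by ring.
have -> : x * (y / x) + (1 - x) * 0 = y by field.
by apply; apply/andP; split; apply: ltW => //; exact: lt_trans kyx.
Qed.

End Coordinates.

(** * The supporting line and its contact segments *)

(** The functional that defines [L] takes at [x] its maximum over the unit ball,
    which is positive; if [x] had norm less than 1, scaling it up within the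
    ball would exceed that maximum. *)
Lemma supporting_norm_ge1 (R : realType) (V : normedModType R) (L : set V) (p x : V) :
  supporting_line (translate unit_ball p) L -> L (p + x) -> 1 <= `|x|.
Proof.
move=> [phi [c [[u phiu] -> sub _]]] /= phix.
have ball y : `|y| <= 1 -> phi y <= phi x.
  move=> y1; have := sub (y + p) (ex_intro2 _ _ y y1 erefl).
  by rewrite /= -phix !linearD /= addrC lerD2l.
have u0 : 0 < `|u|.
  by rewrite normr_gt0; apply/eqP => u0; apply: phiu; rewrite u0 linear0.
have dir (b : R) : `|b| <= 1 -> b / `|u| * phi u <= phi x.
  move=> b1; rewrite -linearZ_LR /=; apply: ball.
  by rewrite normrZ normrM normfV normr_id mulfVK ?lt0r_neq0.
have phix0 : 0 < phi x.
  rewrite ltNge; apply/negP => phix0.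
  have := dir 1; have := dir (- 1); rewrite normrN normr1 lexx => /(_ isT) h1 /(_ isT) h2.
  have : `|u|^-1 * phi u = 0 by lra.
  by move/eqP; rewrite mulf_eq0 invr_eq0 (negPf (lt0r_neq0 u0)) /= => /eqP.
have x0 : 0 < `|x|.
  rewrite normr_gt0; apply/eqP => x0.
  by rewrite x0 linear0 ltxx in phix0.
have := ball (`|x|^-1 *: x).
rewrite normrZ normfV normr_id mulVf ?lt0r_neq0 // => /(_ (lexx _)).
by rewrite linearZ_LR /= ger_pMl // invf_le1.
Qed.

Lemma ray_pt (R : realType) (V : normedModType R) (p e v z : V) (a b y : R) :
  ray (pt p e v a 0) (pt p e v b y) z ->
  exists2 l, 0 <= l & z = pt p e v (l * b + (1 - l) * a) (l * y).
Proof. by move=> [l /= l0 <-]; exists l; rewrite // pt_conv mulr0 addr0. Qed.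

Lemma segment_pt (R : realType) (V : normedModType R) (p e v : V) (a k y x : R) :
  e != 0 -> 0 <= k ->
  segment (pt p e v a y) (pt p e v (a + k) y) (pt p e v x y) <-> a <= x <= a + k.
Proof.
move=> e0 k0; split=> [[l /= /andP[l0 l1]]|/andP[ax xk]].
  rewrite pt_conv (_ : l * y + (1 - l) * y = y); last by ring.
  move=> /(pt_inj _ _ _ _ _ _ e0) <-.
  by have := mulr_ge0 l0 k0; have := ler_wpM2r k0 l1; lra.
have [kE|kn0] := eqVneq k 0.
  have -> : x = a by move: xk; rewrite kE addr0 => xa; apply/eqP; rewrite eq_le ax xa.
  by exists 0; rewrite /= ?lexx ?ler01 // pt_conv kE; congr pt; ring.
have kp : 0 < k by rewrite lt_neqAle eq_sym kn0.
exists ((x - a) / k); last by rewrite pt_conv; congr pt; field.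
by rewrite /= divr_ge0 ?subr_ge0 // ler_pdivrMr // mul1r; lra.
Qed.

Lemma translate_bd_unit_ball (R : realType) (V : normedModType R) (p w : V) :
  translate (bd unit_ball) p (p + w) <-> `|w| = 1.
Proof.
rewrite bd_unit_ballE; split=> [[u /= u1]|w1]; last by exists w; rewrite // addrC.
by rewrite addrC => /addrI <-.
Qed.

Lemma segment_left (R : realType) (V : normedModType R) (x y : V) : segment x y x.
Proof. by exists 0; rewrite /= ?lexx ?ler01 // scale0r subr0 scale1r add0r. Qed.

Lemma parallel_to_through (R : realType) (V : normedModType R) (L : set V) (p q x0 : V) :
  parallel_to L p q -> L x0 -> L = [set x0 + r *: (q - p) | r in [set: R]].
Proof.
move=> [a ->].
have lineE l : l *: (a + (q - p)) + (1 - l) *: a = a + l *: (q - p).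
  by rewrite scalerDr addrAC -scalerDl (_ : l + (1 - l) = 1) ?scale1r //; ring.
move=> [l0 _ <-]; rewrite lineE.
apply/seteqP; split=> _ [l _ <-].
  by exists (l - l0); rewrite // lineE -addrA -scalerDl; congr (_ + _ *: _); ring.
by exists (l0 + l); rewrite // lineE -addrA -scalerDl.
Qed.

Theorem proposition2p4 (R : realType) (V : normedModType R)
    (dimV : Vector.axiom 2 V)
    (p q : V) (hpq : p <> q) (hns : ~ strict_pair p q)
    (psi : {scalar V}) (hpsi0 : exists v, psi v <> 0)
    (hpsi : psi (p - q) = 0)
    (Ltop : set V) (hL : top_line psi p q Ltop)
    (tp tp' tq' tq st : V)
    (htp : Ltop `&` translate (bd unit_ball) p = segment tp tp')
    (hlrp : left_to_right p q tp tp')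
    (htq : Ltop `&` translate (bd unit_ball) q = segment tq' tq)
    (hlrq : left_to_right p q tq' tq)
    (hst : ray p tp' `&` ray q tq' = [set st]) :
  (forall z, bis_top1 p q tp tq st z ->
     bis_top1 p q tp tq st `<=` double_cone p q z) /\
  bis_top1 p q tp tq st `<=` conv_hull [set p; q; st].
Proof.
move: hL => [supp _ par above].
set e := q - p; set v := tp - p.
have e0 : e != 0 by rewrite subr_eq0; apply/eqP => pq; apply: hpq.
have qE : q = pt p e v 1 0 by rewrite /pt /vec scale1r scale0r addr0 addrC subrK.
have tpE : tp = pt p e v 0 1 by rewrite /pt /vec scale1r scale0r add0r addrC subrK.
have Ltp : Ltop tp by have := @segment_left _ _ tp tp'; rewrite -htp => -[].
have psie : psi e = 0 by rewrite /e -opprB linearN hpsi oppr0.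
have psiv : 0 < psi v by rewrite /v linearB subr_gt0; exact: above.
have := parallel_to_through _ _ _ _ _ _ par Ltp; rewrite -/e => LE.
rewrite /left_to_right -/e in hlrp hlrq.
clearbody e v.
have LtopE : Ltop = [set pt p e v x 1 | x in [set: R]].
  by rewrite LE; apply: eq_imagel => x _; rewrite tpE pt_addl add0r.
have [k kge0 tpE'] : exists2 k, 0 <= k & tp' = pt p e v k 1.
  case: hlrp => k kge0 /eqP; rewrite subr_eq => /eqP ->; exists k => //.
  by rewrite tpE addrC pt_addl add0r.
have inp x : (Ltop `&` translate (bd unit_ball) p) (pt p e v x 1) <->
    `|vec e v x 1| = 1.
  rewrite LtopE -(translate_bd_unit_ball _ _ p).
  by split=> [[]|].
have inq x : (Ltop `&` translate (bd unit_ball) q) (pt p e v x 1) <->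
    `|vec e v (x - 1) 1| = 1.
  have -> : pt p e v x 1 = q + vec e v (x - 1) 1.
    by rewrite {1}qE pt_vec; congr pt; ring.
  rewrite LtopE -(translate_bd_unit_ball _ _ q).
  by split=> [[]|?] //; split; first by exists x; rewrite // {1}qE pt_vec; congr pt; ring.
have eq1 x : `|vec e v x 1| = 1 <-> 0 <= x <= k.
  by rewrite -inp htp tpE' tpE -{1}(add0r k) segment_pt // add0r.
have Ltq' : Ltop tq' by have := @segment_left _ _ tq' tq; rewrite -htq => -[].
have [a _ aE] : [set pt p e v x 1 | x in [set: R]] tq' by rewrite -LtopE.
have [k' k'ge0 tqE] : exists2 k', 0 <= k' & tq = pt p e v (a + k') 1.
  case: hlrq => k' k'ge0 /eqP; rewrite subr_eq => /eqP ->; exists k' => //.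
  by rewrite -aE addrC pt_addl.
(* The contact segment of [q + B] is that of [p + B] shifted by [e], which
   identifies the endpoints. *)
have eq1' x : 0 <= x - 1 <= k <-> a <= x <= a + k'.
  by rewrite -eq1 -inq htq tqE -aE segment_pt.
have [a1 k'k] : a = 1 /\ k' = k.
  have /andP[h1 h2] : a <= 1 <= a + k' by apply/eq1'; apply/andP; split; lra.
  have /andP[h3 h4] : a <= 1 + k <= a + k' by apply/eq1'; apply/andP; split; lra.
  have /andP[h5 h6] : 0 <= a - 1 <= k by apply/eq1'; apply/andP; split; lra.
  have /andP[h7 h8] : 0 <= a + k' - 1 <= k by apply/eq1'; apply/andP; split; lra.
  by split; lra.
have ge1 x : 1 <= `|vec e v x 1|.
  apply: (supporting_norm_ge1 _ _ _ _ _ supp).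
  by rewrite LtopE; exists x.
have [st1 st2] : ray p tp' st /\ ray q tq' st by have : [set st] st by []; rewrite -hst.
rewrite -{1}(pt00 p e v) tpE' in st1; rewrite qE -aE a1 in st2.
have [l l0 stE] := ray_pt _ _ _ _ _ _ _ _ _ st1.
have [l' _ stE'] := ray_pt _ _ _ _ _ _ _ _ _ st2.
have {}stE : st = pt p e v (l * k) l by rewrite stE; congr pt; ring.
have {}stE' : st = pt p e v 1 l' by rewrite stE'; congr pt; ring.
(* Both rays climb at the same rate, so they meet at equal parameters. *)
have ll' : l = l'.
  have := congr1 psi stE; rewrite stE' /pt /vec !linearD !linearZ_LR /= psie !mulr0 !add0r.
  by move=> /addrI /(mulIf (lt0r_neq0 psiv)) ->.
have lk : l * k = 1.
  by apply/esym/(pt_inj p e v _ _ l e0); rewrite -stE ll' -stE'.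
have k0 : 0 < k.
  rewrite lt_neqAle kge0 andbT eq_sym; apply/eqP => k0.
  by move: lk; rewrite k0 mulr0 => /eqP; rewrite eq_sym oner_eq0.
have lE : l = k^-1 by apply: (mulIf (lt0r_neq0 k0)); rewrite lk mulVf ?lt0r_neq0.
have {stE ll' lk stE'} stE : st = pt p e v 1 k^-1 by rewrite stE lk lE.
have normst : `|st - p| = k^-1.
  rewrite stE ptBl.
  apply/(norm_vec_eq _ _ k) => //; first by rewrite invr_gt0.
  by rewrite ler01 mulfV ?lt0r_neq0 /=.
have coord z : bis_top1 p q tp tq st z ->
    exists x y, z = pt p e v x y /\ bis_coord e v k x y.
  move=> [r /= /andP[_]]; rewrite normst => rk [].
  rewrite qE tpE tqE a1 k'k => /(region1_sub_pt _ _ _ _ _ kge0)[x [y [-> y0 xb]]].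
  rewrite ptBl ptB subr0 => zp zq.
  exists x, y; split=> //; split=> //; first by rewrite zp zq.
  by apply: equidistant_strip => //; rewrite zp ?zq.
split=> [z /coord[x [y [-> zc]]] w /coord[x' [y' [-> wc]]]|z /coord[x [y [-> zc]]]].
  have [l1 [m [lm xE yE]]] := bis_coord_double_cone _ _ _ k0 eq1 _ _ _ _ zc wc.
  exists l1, m; split=> //.
  rewrite qE -[X in X - _](pt00 p e v) !ptB !vecZ !pt_vec; congr pt; rewrite ?xE ?yE; ring.
by rewrite qE stE; exact: bis_coord_conv.
Qed.
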